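(* Let $\mathcal{K}=\mathbb{Q}(\sqrt{-11})$ and let $\mathcal{O}_{11}=\mathbb{Z}[\omega_{11}]$, where $\omega_{11}=\frac{1}{2}(1+i\sqrt{11})$, be the ring of integers of $\mathcal{K}$. Then the group $PU(2,1;\mathcal{O}_{11})$ is generated by the elements $$I_0=\begin{bmatrix}0&0&1\\0&-1&0\\1&0&0\end{bmatrix},\quad R_1=\begin{bmatrix}1&0&0\\0&-1&0\\0&0&1\end{bmatrix},\quad R_2=\begin{bmatrix}1&1&-\bar{\omega}_{11}\\0&-1&1\\0&0&1\end{bmatrix},$$ $$R_3=\begin{bmatrix}1&\bar{\omega}_{11}&-1-\bar{\omega}_{11}\\0&-1&\omega_{11}\\0&0&1\end{bmatrix}\quad\text{and}\quad T=\begin{bmatrix}1&0&i\sqrt{11}\\0&1&0\\0&0&1\end{bmatrix}.$$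
   Context: $\mathbb{C}^{2,1}$ is $\mathbb{C}^3$ with the Hermitian form $\langle \mathbf{z},\mathbf{w}\rangle=z_1\bar{w}_3+z_2\bar{w}_2+z_3\bar{w}_1$. $U(2,1)$ is the group of $3\times 3$ complex matrices preserving this form, and $PU(2,1)=U(2,1)/U(1)$, where $U(1)=\{e^{i\theta}I\}$ is the group of scalar unitary matrices. $PU(2,1;\mathcal{O})$ denotes the subgroup of $PU(2,1)$ consisting of classes of matrices in $U(2,1)$ all of whose entries lie in the ring $\mathcal{O}$. Matrices stand for their classes in $PU(2,1)$. *)

(* Defs.v *)
From HB Require Import structures.
From mathcomp Require Import all_boot all_order all_algebra.
From mathcomp Require Import boolp classical_sets reals trigo.
From mathcomp Require Import generic_quotient complex.
From mathcomp Require Import ring.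

Set Implicit Arguments.
Unset Strict Implicit.
Unset Printing Implicit Defensive.

Import Order.TTheory GRing.Theory Num.Theory.
Local Open Scope classical_set_scope.
Local Open Scope ring_scope.
Local Open Scope quotient_scope.

Section GeneratedSubgroup.
Local Open Scope group_scope.
Variable G : groupType.

Definition subgroup (H : set G) : Prop :=
  [/\ H 1, forall x y, H x -> H y -> H (x * y) & forall x, H x -> H x^-1].

Definition generated (S : set G) : set G := smallest subgroup S.

End GeneratedSubgroup.

Section U21.
Variable R : realType.
Local Notation C := R[i].

Definition herm (z w : 'cV[C]_3) : C :=
  z 0 0 * (w 2 0)^* + z 1 0 * (w 1 0)^* + z 2 0 * (w 0 0)^*.

Definition preserves_herm (A : 'M[C]_3) : Prop :=
  forall z w : 'cV[C]_3, herm (A *m z) (A *m w) = herm z w.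

(* Preserving the form forces invertibility, see [preserves_herm_unit]. *)
Record U21 := MkU21 { U21_mx :> 'M[C]_3 ; _ : `[< preserves_herm U21_mx >] }.

HB.instance Definition _ := [isSub for U21_mx].
HB.instance Definition _ := [Choice of U21 by <:].

Lemma U21P (A : U21) : preserves_herm A.
Proof. by case: A => A /= /asboolP. Qed.

Definition mkU21 (A : 'M[C]_3) (hA : preserves_herm A) : U21 :=
  MkU21 (introT (asboolP _) hA).

Lemma preserves_herm_unit (A : 'M[C]_3) : preserves_herm A -> A \in unitmx.
Proof.
move=> hA; pose L := \matrix_(k < 3, i < 3) (A (rev_ord i) (rev_ord k))^*.
suff /mulmx1_unit[] : L *m A = 1%:M by [].
apply/matrixP => k j.
have -> : (L *m A) k j =
    herm (A *m delta_mx j 0) (A *m delta_mx (rev_ord k) 0).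
  rewrite -!colE /herm !mxE !big_ord_recl big_ord0 addr0 !mxE addrA.
  rewrite ![_ * A _ _]mulrC.
  by congr (_ * (A _ _)^* + _ * (A _ _)^* + _ * (A _ _)^*);
     try congr (A _ _); apply/val_inj.
rewrite hA /herm !mxE !eqxx !andbT.
case: k => [[|[|[|//]]] ?]; case: j => [[|[|[|//]]] ?];
  by rewrite -!val_eqE /= ?(conjC0, conjC1, mulr0, mul0r, mulr1, addr0, add0r).
Qed.

Lemma preserves_herm1 : preserves_herm 1%:M.
Proof. by move=> z w; rewrite !mul1mx. Qed.

Lemma preserves_hermM (A B : U21) : preserves_herm (A *m B).
Proof. by move=> z w; rewrite -!mulmxA !U21P. Qed.

Lemma preserves_hermV (A : U21) : preserves_herm (invmx A).
Proof.
have uA := preserves_herm_unit (U21P A).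
by move=> z w; rewrite -[LHS](U21P A) !mulmxA mulmxV // !mul1mx.
Qed.

Definition U21_one : U21 := mkU21 preserves_herm1.
Definition U21_mul (A B : U21) : U21 := mkU21 (@preserves_hermM A B).
Definition U21_inv (A : U21) : U21 := mkU21 (@preserves_hermV A).

Lemma U21_mulA : associative U21_mul.
Proof. by move=> A B D; apply/val_inj; rewrite /= mulmxA. Qed.

Lemma U21_mul1 : left_id U21_one U21_mul.
Proof. by move=> A; apply/val_inj; rewrite /= mul1mx. Qed.

Lemma U21_mulr1 : right_id U21_one U21_mul.
Proof. by move=> A; apply/val_inj; rewrite /= mulmx1. Qed.

Lemma U21_mulV : left_inverse U21_one U21_inv U21_mul.
Proof.
by move=> A; apply/val_inj; rewrite /= mulVmx // preserves_herm_unit //; apply: U21P.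
Qed.

Lemma U21_mulrV : right_inverse U21_one U21_inv U21_mul.
Proof.
by move=> A; apply/val_inj; rewrite /= mulmxV // preserves_herm_unit //; apply: U21P.
Qed.

HB.instance Definition _ :=
  isGroup.Build U21 U21_mulA U21_mul1 U21_mulr1 U21_mulV U21_mulrV.

Definition expi (t : R) : C := Complex (cos t) (sin t).

Lemma expi0 : expi 0 = 1.
Proof. by rewrite /expi cos0 sin0. Qed.

Lemma expiD (s t : R) : expi (s + t) = expi s * expi t.
Proof.
by apply/eqP; rewrite eq_complex /= cosD sinD [sin s * _ + _]addrC !eqxx.
Qed.

Lemma expi_neq0 (t : R) : expi t != 0.
Proof.
apply/eqP => t0; have := expiD t (- t).
by rewrite subrr expi0 t0 mul0r => /eqP; rewrite oner_eq0.
Qed.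

(* Equality modulo U(1) = {e^{it} I}. *)
Definition U1_equiv (A B : U21) : bool :=
  `[< exists t : R, (A : 'M[C]_3) = (expi t)%:M *m B >].

Lemma U1_equiv_equiv : equiv_class_of U1_equiv.
Proof.
split=> [A|A B|B A D].
- by apply/asboolP; exists 0; rewrite expi0 mul1mx.
- have sym (A' B' : U21) : U1_equiv A' B' -> U1_equiv B' A'.
    move=> /asboolP[t AB]; apply/asboolP; exists (- t).
    by rewrite AB mulmxA -scalar_mxM -expiD addNr expi0 mul1mx.
  by apply/idP/idP; apply: sym.
- move=> /asboolP[s AB] /asboolP[t BD]; apply/asboolP; exists (s + t).
  by rewrite AB BD mulmxA -scalar_mxM -expiD.
Qed.

Canonical U1_equiv_canonical := EquivRelPack U1_equiv_equiv.

Definition PU21 := {eq_quot U1_equiv}.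
HB.instance Definition _ := Choice.on PU21.
HB.instance Definition _ := EqQuotient.on PU21.

Definition PU21_class (A : U21) : PU21 := \pi_PU21 A.

Lemma PU21_classP (A B : U21) :
  PU21_class A = PU21_class B <->
  exists t : R, (A : 'M[C]_3) = (expi t)%:M *m B.
Proof.
split=> [/eqmodP/asboolP//|AB].
by apply/eqmodP/asboolP.
Qed.

Lemma PU21_reprK (x : PU21) : PU21_class (repr x) = x.
Proof. exact: reprK. Qed.

Definition PU21_one : PU21 := PU21_class 1%g.
(* Independent of the chosen representatives: see [PU21_classM] and
   [PU21_classV]. *)
Definition PU21_mul (x y : PU21) : PU21 := PU21_class (repr x * repr y)%g.
Definition PU21_inv (x : PU21) : PU21 := PU21_class (repr x)^-1%g.

Lemma PU21_classM (A B : U21) :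
  PU21_class (A * B)%g = PU21_mul (PU21_class A) (PU21_class B).
Proof.
have /PU21_classP[s Es] := esym (PU21_reprK (PU21_class A)).
have /PU21_classP[t Et] := esym (PU21_reprK (PU21_class B)).
apply/PU21_classP; exists (s + t).
rewrite /= Es Et expiD scalar_mxM -!mulmxA; congr (_ *m _).
by rewrite !mulmxA scalar_mxC.
Qed.

Lemma PU21_classV (A : U21) :
  PU21_class (A^-1)%g = PU21_inv (PU21_class A).
Proof.
have /PU21_classP[s Es] := esym (PU21_reprK (PU21_class A)).
apply/PU21_classP; exists (- s).
set B : U21 := repr _ in Es *.
have uA := preserves_herm_unit (U21P A).
have uB := preserves_herm_unit (U21P B).
change (invmx A = (expi (- s))%:M *m invmx B).
apply: (can_inj (mulKmx uA)); rewrite mulmxV // {1}Es.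
rewrite -[RHS]mulmxA [B *m _]mulmxA scalar_mxC -[_ *m invmx B]mulmxA.
by rewrite mulmxV // mulmx1 -scalar_mxM -expiD subrr expi0.
Qed.

Lemma PU21_mulA : associative PU21_mul.
Proof.
move=> x y z; rewrite -[x]PU21_reprK -[y]PU21_reprK -[z]PU21_reprK.
by rewrite -!PU21_classM mulgA.
Qed.

Lemma PU21_mul1 : left_id PU21_one PU21_mul.
Proof. by move=> x; rewrite -[x]PU21_reprK -PU21_classM mul1g. Qed.

Lemma PU21_mulr1 : right_id PU21_one PU21_mul.
Proof. by move=> x; rewrite -[x]PU21_reprK -PU21_classM mulg1. Qed.

Lemma PU21_mulV : left_inverse PU21_one PU21_inv PU21_mul.
Proof.
by move=> x; rewrite -[x]PU21_reprK -PU21_classV -PU21_classM mulVg.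
Qed.

Lemma PU21_mulrV : right_inverse PU21_one PU21_inv PU21_mul.
Proof.
by move=> x; rewrite -[x]PU21_reprK -PU21_classV -PU21_classM mulgV.
Qed.

HB.instance Definition _ :=
  isGroup.Build PU21 PU21_mulA PU21_mul1 PU21_mulr1 PU21_mulV PU21_mulrV.

(* The classes having a representative in U(2,1) with all entries in O; other
   representatives of such a class need not have entries in O. *)
Definition PU21_over (O : set C) : set PU21 :=
  [set PU21_class A | A in [set A : U21 | forall i j, O (A i j)]].

(* i * sqrt 11 *)
Definition isqrt11 : C := Complex 0 (Num.sqrt 11).
Definition omega11 : C := 2^-1 * (1 + isqrt11).
(* Z[omega11]: the values at omega11 of the integer polynomials. *)
Definition O11 : set C := [set (map_poly intr p).[omega11] | p in [set: {poly int}]].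

Lemma isqrt11_sqr : isqrt11 ^+ 2 = - 11.
Proof.
apply/eqP; rewrite eq_complex !raddfN /= !(mulr0, mul0r, addr0, sub0r, oppr0).
by rewrite -expr2 sqr_sqrtr ?ler0n // !eqxx.
Qed.

Lemma isqrt11_conj : isqrt11^* = - isqrt11.
Proof. by apply/eqP; rewrite eq_complex /= oppr0 !eqxx. Qed.

Lemma omega11_conj : omega11^* = 1 - omega11.
Proof.
rewrite /omega11 rmorphM fmorphV rmorph_nat rmorphD rmorph1 /= isqrt11_conj.
by field.
Qed.

Lemma omega11_sqr : omega11 ^+ 2 = omega11 - 3.
Proof.
by rewrite /omega11 exprMn sqrrD isqrt11_sqr; field.
Qed.

Definition mx3 (s : seq (seq C)) : 'M[C]_3 := \matrix_(i, j) (nth [::] s i)`_j.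

Definition I0_mx : 'M[C]_3 :=
  mx3 [:: [:: 0;  0; 1];
          [:: 0; -1; 0];
          [:: 1;  0; 0]].

Definition R1_mx : 'M[C]_3 :=
  mx3 [:: [:: 1;  0; 0];
          [:: 0; -1; 0];
          [:: 0;  0; 1]].

Definition R2_mx : 'M[C]_3 :=
  mx3 [:: [:: 1;  1; - omega11^*];
          [:: 0; -1;           1];
          [:: 0;  0;           1]].

Definition R3_mx : 'M[C]_3 :=
  mx3 [:: [:: 1; omega11^*; -1 - omega11^*];
          [:: 0;        -1;        omega11];
          [:: 0;         0;              1]].

Definition T_mx : 'M[C]_3 :=
  mx3 [:: [:: 1; 0; isqrt11];
          [:: 0; 1;       0];
          [:: 0; 0;       1]].

Let mx3E (s : seq (seq C)) (z : 'cV[C]_3) (i : 'I_3) :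
  (mx3 s *m z) i 0 = (nth [::] s i)`_0 * z 0 0
    + (nth [::] s i)`_1 * z 1 0 + (nth [::] s i)`_2 * z 2 0.
Proof.
rewrite mxE !big_ord_recl big_ord0 addr0 !mxE /= addrA.
by congr (_ * z _ _ + _ * z _ _ + _ * z _ _); apply/val_inj.
Qed.

Let simp := (rmorphD, rmorphN, rmorphM, rmorph1, rmorph0).

Lemma I0_mxP : preserves_herm I0_mx.
Proof. by move=> z w; rewrite /herm !mx3E /= !simp /=; ring. Qed.

Lemma R1_mxP : preserves_herm R1_mx.
Proof. by move=> z w; rewrite /herm !mx3E /= !simp /=; ring. Qed.

Lemma R2_mxP : preserves_herm R2_mx.
Proof.
move=> z w; rewrite /herm !mx3E /=; move: omega11 omega11_conj => o oC.
by rewrite oC !simp /= oC; ring.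
Qed.

Lemma R3_mxP : preserves_herm R3_mx.
Proof.
move=> z w; rewrite /herm !mx3E /=.
move: omega11 omega11_conj omega11_sqr => o oC o2.
by rewrite oC !simp /= oC; ring: o2.
Qed.

Lemma T_mxP : preserves_herm T_mx.
Proof.
move=> z w; rewrite /herm !mx3E /=; move: isqrt11 isqrt11_conj => r rC.
by rewrite !simp /= rC; ring.
Qed.

Definition PU_I0 : PU21 := PU21_class (mkU21 I0_mxP).
Definition PU_R1 : PU21 := PU21_class (mkU21 R1_mxP).
Definition PU_R2 : PU21 := PU21_class (mkU21 R2_mxP).
Definition PU_R3 : PU21 := PU21_class (mkU21 R3_mxP).
Definition PU_T : PU21 := PU21_class (mkU21 T_mxP).

End U21.

Arguments O11 R : clear implicits.

(* Main.v *)
Require Import Defs.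
From mathcomp Require Import all_boot all_order all_algebra.
From mathcomp Require Import boolp classical_sets reals trigo complex.
From Stdlib Require Import ZArith Lia.

(** One inclusion is clear: the five generators have entries in O, and the
    matrices of U(2,1) with entries in O form a group, because the inverse of a
    matrix is its conjugate, transposed along the antidiagonal.

    For the other one, let A be in U(2,1) with entries in O. Its first column z
    is a null vector of O^3, and A fixes the point at infinity of the boundary
    of complex hyperbolic space as soon as the last entry z3 of z vanishes. The
    proof is a Euclidean descent on the norm of z3: while z3 is not 0, some
    product g of generators makes the norm of the last entry of g z smaller
    than that of z3 ([height_descent]).

    The moves used are the inversion I_0 and the integral Heisenberg
    translations. The inversion exchanges z1 and z3, so it makes progress when
    |z1| < |z3|. In the Heisenberg coordinates (zeta, t) of the boundary point
    z / z3, where z1 / z3 = (- |zeta|^2 + i t) / 2, this is the inside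
    |zeta|^4 + t^2 < 4 of the isometric sphere of I_0, called the unit ball
    below. Translations bring (zeta, t) into a fixed box ([shift_into_box]), and
    it is enough to cover this box by finitely many translates of the unit ball.
    Thirteen translates do. The covering is verified by a computation with
    integers ([box_covered]): the box is subdivided until each piece lies in one
    of the balls.

    When the descent stops, the matrix is upper triangular. The only units of O
    are 1 and -1, so up to sign and up to R_1 it is a Heisenberg translation
    ([in_gen_stabilizer]). The translations are generated by T, R_2 R_1 and
    R_3 R_1, which translate vertically, by 1 and by omega ([in_gen_heis]). *)

Set Implicit Arguments.
Unset Strict Implicit.
Unset Printing Implicit Defensive.

Local Open Scope Z_scope.

Local Arguments Z.mul : simpl never.
Local Arguments Z.add : simpl never.
Local Arguments Z.sub : simpl never.
Local Arguments Z.opp : simpl never.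

(** * Integers of Q(sqrt(-11)) as pairs of integers *)

(** The pair (a, b) stands for a + b omega, where omega^2 = omega - 3. Binary
    integers are used so that the covering can be computed. *)
Notation OZ := (Z * Z)%type.

Definition addO (x y : OZ) : OZ := (x.1 + y.1, x.2 + y.2).
Definition oppO (x : OZ) : OZ := (- x.1, - x.2).
Definition mulO (x y : OZ) : OZ :=
  (x.1 * y.1 - 3 * (x.2 * y.2), x.1 * y.2 + x.2 * y.1 + x.2 * y.2).
Definition conjO (x : OZ) : OZ := (x.1 + x.2, - x.2).
Definition trO (x : OZ) : Z := 2 * x.1 + x.2.
Definition normO (x : OZ) : Z := x.1 * x.1 + x.1 * x.2 + 3 * (x.2 * x.2).

Lemma normO_trE x : 4 * normO x = trO x * trO x + 11 * (x.2 * x.2).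
Proof. rewrite /normO /trO; ring. Qed.

Lemma normO_ge0 x : 0 <= normO x.
Proof. have := normO_trE x; nia. Qed.

Lemma normO_le1 x : normO x <= 1 -> x.2 = 0 /\ normO x = x.1 * x.1.
Proof.
move=> le1; have x2 : x.2 = 0 by have := normO_trE x; nia.
by split=> //; rewrite /normO x2; ring.
Qed.

Lemma normO_eq0 x : normO x = 0 -> x = (0, 0).
Proof.
move=> x0; have [] := @normO_le1 x; first lia.
by rewrite x0; case: x {x0} => a b /= -> h; congr pair; nia.
Qed.

Lemma normO_eq1 x : normO x = 1 -> x = (1, 0) \/ x = (-1, 0).
Proof.
move=> x1; have [] := @normO_le1 x; first lia.
rewrite x1; case: x {x1} => a b /= -> h.
have [->|->] : a = 1 \/ a = -1 by nia.
- by left.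
- by right.
Qed.

Lemma normO_mul x y : normO (mulO x y) = normO x * normO y.
Proof. rewrite /normO /mulO /=; ring. Qed.

(** * Words in the moves, acting on null vectors *)

Record vecO := VecO { v1 : OZ; v2 : OZ; v3 : OZ }.

Definition null (z : vecO) : Prop :=
  normO (v2 z) + trO (mulO (v1 z) (conjO (v3 z))) = 0.

(** The corner entry v of a Heisenberg translation by tau = a + b omega must
    satisfy v + conj v = - |tau|^2. As omega + conj omega = 1, one solution is
    - |tau|^2 omega, and the others differ from it by the integer multiples
    j (2 omega - 1) = j i sqrt 11. *)
Definition shift_corner (a b j : Z) : OZ := (- j, 2 * j - normO (a, b)).

(** [Shift a b j] is the Heisenberg translation by a + b omega with vertical
    parameter j, and [Flip] is the inversion I_0. *)
Inductive move := Shift of Z & Z & Z | Flip.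

Definition move_vec (m : move) (z : vecO) : vecO :=
  match m with
  | Shift a b j =>
      VecO (addO (addO (v1 z) (oppO (mulO (conjO (a, b)) (v2 z))))
                 (mulO (shift_corner a b j) (v3 z)))
           (addO (v2 z) (mulO (a, b) (v3 z)))
           (v3 z)
  | Flip => VecO (v3 z) (oppO (v2 z)) (v1 z)
  end.

Definition word_vec (g : seq move) (z : vecO) : vecO :=
  foldl (fun z m => move_vec m z) z g.

Lemma move_vec_null m z : null z -> null (move_vec m z).
Proof.
case: m => [a b j|]; case: z => -[? ?] [? ?] [? ?];
  rewrite /null /= /trO /shift_corner /normO /addO /oppO /mulO /conjO /= => h;
  rewrite -[RHS]h; ring.
Qed.

Lemma word_vec_null g z : null z -> null (word_vec g z).
Proof. by elim: g z => //= m g IHg z /move_vec_null/IHg. Qed.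

(** * The boundary chart *)

(** Write theta = i sqrt 11 and n = |z3|^2. These are the integers p, q, s such
    that z2 conj z3 = (p + q theta) / 2 and, for a null vector z,
    z1 conj z3 = (- |z2|^2 + s theta) / 2, so zeta = (p + q theta) / (2 n) and
    t = s sqrt 11 / n. Boxes are taken in the coordinates (p, q, s) / n. *)
Definition chart_x (z : vecO) : Z := trO (mulO (v2 z) (conjO (v3 z))).
Definition chart_y (z : vecO) : Z := (mulO (v2 z) (conjO (v3 z))).2.
Definition chart_s (z : vecO) : Z := (mulO (v1 z) (conjO (v3 z))).2.
Definition chart_n (z : vecO) : Z := normO (v3 z).

Lemma chart_x_shift a b j z :
  chart_x (move_vec (Shift a b j) z) = chart_x z + (2 * a + b) * chart_n z.
Proof.
rewrite /chart_x /chart_n /trO /normO /addO /mulO /conjO /=; ring.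
Qed.

Lemma chart_y_shift a b j z :
  chart_y (move_vec (Shift a b j) z) = chart_y z + b * chart_n z.
Proof. rewrite /chart_y /chart_n /normO /addO /mulO /conjO /=; ring. Qed.

Lemma chart_s_shift a b j z :
  2 * chart_s (move_vec (Shift a b j) z) =
  2 * chart_s z + b * chart_x z - (2 * a + b) * chart_y z
  + 2 * (2 * j - normO (a, b)) * chart_n z.
Proof.
rewrite /chart_s /= /chart_x /chart_y /chart_n /trO /shift_corner /normO.
rewrite /addO /oppO /mulO /conjO /=; ring.
Qed.

(** This is 16 n^4 (|zeta|^4 + t^2), with s2 = 2 s: doubling keeps the shear of
    [chart_s_shift] integral. *)
Definition ball_form (x y s2 n : Z) : Z :=
  (x * x + 11 * (y * y)) * (x * x + 11 * (y * y)) + 44 * (s2 * s2 * (n * n)).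

(** Since |zeta|^4 + t^2 = 4 |z1 / z3|^2, the norm of z1 is smaller than n exactly
    when the value of [ball_form] is smaller than 64 n^4. *)
Lemma ball_formP z : null z ->
  ball_form (chart_x z) (chart_y z) (2 * chart_s z) (chart_n z) =
  64 * (chart_n z * chart_n z * chart_n z) * normO (v1 z).
Proof.
move=> z0; set n := chart_n z; set w := mulO (v1 z) (conjO (v3 z)).
have norm_conj : normO (conjO (v3 z)) = n by rewrite /n /chart_n /normO /conjO /=; ring.
have -> : 64 * (n * n * n) * normO (v1 z) = 16 * (n * n) * (4 * normO w).
  rewrite /w normO_mul norm_conj; ring.
have xyE : chart_x z * chart_x z + 11 * (chart_y z * chart_y z) = - 4 * trO w * n.
  rewrite -normO_trE normO_mul norm_conj.
  have -> : trO w = - normO (v2 z) by move: z0; rewrite /null -/w; lia.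
  ring.
rewrite /ball_form xyE normO_trE /chart_s -/w; ring.
Qed.

(** * Covering a fundamental box by unit balls *)

(** Tests that the box with centre (x, y, s) / d and half-widths (2, 1, 2) / d
    goes into the unit ball under the translation h. The form is increasing in
    the absolute values of its arguments, and each of them is bounded by its
    absolute value at the centre plus its variation over the box. *)
Definition box_in_ball (h : Z * Z * Z) (x y s d : Z) : bool :=
  let: (a, b, j) := h in
  ball_form (Z.abs (x + (2 * a + b) * d) + 2) (Z.abs (y + b * d) + 1)
    (Z.abs (2 * s + b * x - (2 * a + b) * y + 2 * (2 * j - normO (a, b)) * d)
     + (4 + Z.abs b * 2 + Z.abs (2 * a + b))) d
  <? 64 * (d * d * (d * d)).

(** The translations by the tau in O of norm at most 3, with the vertical
    parameters j such that 2 j - |tau|^2 is 0, 1 or -1. *)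
Definition unit_shifts : seq (Z * Z * Z) :=
  [:: (0, 0, 0); (1, 0, 0); (-1, 0, 0); (1, 0, 1); (-1, 0, 1);
      (0, 1, 1); (0, -1, 1); (0, 1, 2); (0, -1, 2);
      (1, -1, 1); (-1, 1, 1); (1, -1, 2); (-1, 1, 2)].

(** Halving a box in the three directions amounts to doubling the scale d: the
    half-widths stay (2, 1, 2), and k bounds the number of halvings. *)
Fixpoint covered (k : nat) (x y s d : Z) : bool :=
  if has (fun h => box_in_ball h x y s d) unit_shifts then true
  else if k is k'.+1 then
    all (fun c => covered k' (2 * x + 2 * c.1.1) (2 * y + c.1.2)
                             (2 * s + 2 * c.2) (2 * d))
      [:: (-1, -1, -1); (-1, -1, 1); (-1, 1, -1); (-1, 1, 1);
          (1, -1, -1); (1, -1, 1); (1, 1, -1); (1, 1, 1)]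
  else false.

(** This is the box |x| <= 1, |y| <= 1/2, |s| <= 1. A few of its points lie close
    to the boundary of the union of the balls, hence the eight halvings. *)
Lemma box_covered : covered 8 0 0 0 2.
Proof. by vm_compute. Qed.

Lemma abs_mul_le a u b : Z.abs u <= b -> Z.abs (a * u) <= Z.abs a * b.
Proof. by move=> ub; rewrite Z.abs_mul; apply: Z.mul_le_mono_nonneg_l; lia. Qed.

Lemma sqr_le u v : Z.abs u <= v -> u * u <= v * v.
Proof.
move=> uv; rewrite -(Z.abs_square u).
by apply: Z.mul_le_mono_nonneg => //; apply: Z.abs_nonneg.
Qed.

Lemma ball_form_le x y s n x' y' s' n' :
  Z.abs x <= x' -> Z.abs y <= y' -> Z.abs s <= s' -> Z.abs n <= n' ->
  ball_form x y s n <= ball_form x' y' s' n'.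
Proof.
move=> /sqr_le hx /sqr_le hy /sqr_le hs /sqr_le hn.
have sq u : 0 <= u * u by apply: Z.square_nonneg.
have hxy : (x * x + 11 * (y * y)) * (x * x + 11 * (y * y))
    <= (x' * x' + 11 * (y' * y')) * (x' * x' + 11 * (y' * y')).
  apply: sqr_le; rewrite Z.abs_eq; first by lia.
  have := sq x; have := sq y; lia.
have hsn : s * s * (n * n) <= s' * s' * (n' * n') by apply: Z.mul_le_mono_nonneg.
rewrite /ball_form; lia.
Qed.

(** The point of the box is (p, q, t) / n, and all fractions are cleared. *)
Lemma box_in_ball_sound a b j x y s d p q t n :
  0 < n -> 0 < d ->
  Z.abs (d * p - x * n) <= 2 * n -> Z.abs (d * q - y * n) <= n ->
  Z.abs (d * t - s * n) <= 2 * n ->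
  box_in_ball (a, b, j) x y s d ->
  ball_form (p + (2 * a + b) * n) (q + b * n)
    (2 * t + b * p - (2 * a + b) * q + 2 * (2 * j - normO (a, b)) * n) n
  < 64 * (n * n * (n * n)).
Proof.
move=> n0 d0 hp hq ht; rewrite /box_in_ball.
set x' := Z.abs _ + 2; set y' := Z.abs _ + 1; set s' := Z.abs _ + _.
move=> /Z.ltb_lt small.
set P := p + _; set Q := q + _; set S := 2 * t + _ - _ + _.
have absn u : Z.abs (u * n) <= Z.abs u * n.
  by apply: abs_mul_le; rewrite Z.abs_eq; lia.
have hP : Z.abs (d * P) <= x' * n.
  have := absn (x + (2 * a + b) * d); rewrite /P /x'; clear -hp; lia.
have hQ : Z.abs (d * Q) <= y' * n.
  have := absn (y + b * d); rewrite /Q /y'; clear -hq; lia.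
have hS : Z.abs (d * S) <= s' * n.
  move: (abs_mul_le (a := b) hp) (abs_mul_le (a := 2 * a + b) hq).
  rewrite /S /s'; set c := 2 * s + _ - _ + _.
  move: (absn c) ht; rewrite !Z.abs_le /c; clear.
  move: (2 * a + b) (normO _) => A N.
  move: (Z.abs _) (Z.abs b) (Z.abs A) => C B A'; lia.
have hn : Z.abs (d * n) <= d * n.
  by apply: Z.eq_le_incl; apply: Z.abs_eq; apply: Z.mul_nonneg_nonneg; lia.
have := ball_form_le hP hQ hS hn.
have n4 : 0 < n * n * (n * n) by do !apply: Z.mul_pos_pos.
have d4 : 0 < d * d * (d * d) by do !apply: Z.mul_pos_pos.
have scale u v w z r : ball_form (r * u) (r * v) (r * w) (r * z)
   = r * r * (r * r) * ball_form u v w z by rewrite /ball_form; ring.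
have -> : ball_form (x' * n) (y' * n) (s' * n) (d * n)
   = n * n * (n * n) * ball_form x' y' s' d by rewrite -scale; congr ball_form; ring.
rewrite scale => le.
apply/(proj2 (Z.mul_lt_mono_pos_l _ _ _ d4)); apply: Z.le_lt_trans le _.
have := proj1 (Z.mul_lt_mono_pos_l _ _ _ n4) small; lia.
Qed.

Lemma covered_sound k x y s d p q t n :
  0 < n -> 0 < d ->
  Z.abs (d * p - x * n) <= 2 * n -> Z.abs (d * q - y * n) <= n ->
  Z.abs (d * t - s * n) <= 2 * n ->
  covered k x y s d ->
  exists a b j, ball_form (p + (2 * a + b) * n) (q + b * n)
    (2 * t + b * p - (2 * a + b) * q + 2 * (2 * j - normO (a, b)) * n) n
  < 64 * (n * n * (n * n)).
Proof.
move=> n0; elim: k x y s d => [|k IHk] x y s d d0 hp hq ht; rewrite /covered -/covered;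
  case: ifP => //; try by move=> /(has_nthP (0, 0, 0))[i _]; case: nth => -[a b] j
    /(box_in_ball_sound n0 d0 hp hq ht) ?; exists a, b, j.
move=> _.
have d2 : 0 < 2 * d by lia.
have cx : Z.abs (2 * d * p - (2 * x + 2 * -1) * n) <= 2 * n
       \/ Z.abs (2 * d * p - (2 * x + 2 * 1) * n) <= 2 * n by lia.
have cy : Z.abs (2 * d * q - (2 * y + -1) * n) <= n
       \/ Z.abs (2 * d * q - (2 * y + 1) * n) <= n by lia.
have cs : Z.abs (2 * d * t - (2 * s + 2 * -1) * n) <= 2 * n
       \/ Z.abs (2 * d * t - (2 * s + 2 * 1) * n) <= 2 * n by lia.
case/andP=> c1 /andP[c2 /andP[c3 /andP[c4 /andP[c5 /andP[c6 /andP[c7 /andP[c8 _]]]]]]].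
by case: cx => hx; case: cy => hy; case: cs => hs;
  [move: c1|move: c2|move: c3|move: c4|move: c5|move: c6|move: c7|move: c8];
  apply: IHk.
Qed.

Lemma round_shift n u : 0 < n -> exists k, Z.abs (2 * (u + k * n)) <= n.
Proof.
move=> n0; exists (- ((2 * u + n) / (2 * n))).
have := Z.div_mod (2 * u + n) (2 * n); have := Z.mod_pos_bound (2 * u + n) (2 * n).
nia.
Qed.

(** Translating by a + b omega adds 2 a + b to the first coordinate and b to the
    second, so b is chosen before a; the vertical parameter then moves the third
    by even integers. *)
Lemma shift_into_box z : 0 < chart_n z -> exists a b j,
  let z' := move_vec (Shift a b j) z in
  [/\ Z.abs (chart_x z') <= chart_n z, Z.abs (2 * chart_y z') <= chart_n z
    & Z.abs (chart_s z') <= chart_n z].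
Proof.
move=> n0; have n2 : 0 < 2 * chart_n z by lia.
have [b hb] := round_shift (chart_y z) n0.
have [a ha] := round_shift (chart_x z + b * chart_n z) n2.
have [j hj] := round_shift (chart_s (move_vec (Shift a b 0) z)) n2.
exists a, b, j; cbv zeta; have := chart_s_shift a b j z; have := chart_s_shift a b 0 z.
rewrite chart_x_shift chart_y_shift => s0E sE; split; lia.
Qed.

(** One translation into the box, one into the unit ball, then the inversion. *)
Lemma height_descent z : null z -> v3 z <> (0, 0) ->
  exists g, normO (v3 (word_vec g z)) < normO (v3 z).
Proof.
move=> z0 z3; have n0 : 0 < chart_n z.
  have := @normO_ge0 (v3 z); rewrite /chart_n.
  by case: (Z.eq_dec (normO (v3 z)) 0) => [/normO_eq0//|]; lia.
have [a [b [j [hx hy hs]]]] := shift_into_box n0.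
set z' := move_vec _ z in hx hy hs.
have [||||a' [b' [j' lt]]] := covered_sound (p := chart_x z') (q := chart_y z')
  (t := chart_s z') (n := chart_n z) n0 _ _ _ _ box_covered; try lia.
set m' := Shift a' b' j'; have z''0 : null (move_vec m' z') by do 2!apply: move_vec_null.
have n3 : 0 < 64 * (chart_n z * chart_n z * chart_n z) by nia.
exists [:: Shift a b j; m'; Flip]; apply/(proj2 (Z.mul_lt_mono_pos_l _ _ _ n3)).
have := ball_formP z''0.
rewrite chart_x_shift chart_y_shift chart_s_shift.
have -> : chart_n (move_vec m' z') = chart_n z by [].
have -> : chart_n z' = chart_n z by [].
move: lt; rewrite -/(chart_n z) /= -/m' -/z'; lia.
Qed.

(** Infinite descent: the norms of the last entries are natural numbers. *)
Lemma reach_horizontal z : null z -> exists g, v3 (word_vec g z) = (0, 0).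
Proof.
have [k] := ubnP (Z.to_nat (normO (v3 z))); elim: k z => // k IHk z ltk z0.
have [z3|/height_descent-/(_ z0)[g ltg]] :
  v3 z = (0, 0) \/ v3 z <> (0, 0) by case: (v3 z) => -[|?|?] [|?|?]; by [left|right].
- by exists [::].
have := @normO_ge0 (v3 (word_vec g z)) => ge0.
have [||g' g'0] := IHk (word_vec g z); first by apply/ltP; move/ltP: ltk; lia.
- exact: word_vec_null.
by exists (g ++ g'); rewrite /word_vec foldl_cat.
Qed.

(** * Matrices with entries in O *)

From mathcomp Require Import ssrZ ring.

Import Order.TTheory GRing.Theory Num.Theory.
Local Open Scope ring_scope.
Delimit Scope Z_scope with coqZ.

Section Matrices.
Variable R : realType.
Local Notation C := R[i].
Local Notation omega := (omega11 R).

Definition ZtoC (a : Z) : C := (int_of_Z a)%:~R.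

Lemma ZtoCD a b : ZtoC (a + b)%coqZ = ZtoC a + ZtoC b.
Proof. by rewrite /ZtoC (rmorphD int_of_Z) rmorphD. Qed.
Lemma ZtoCM a b : ZtoC (a * b)%coqZ = ZtoC a * ZtoC b.
Proof. by rewrite /ZtoC (rmorphM int_of_Z) rmorphM. Qed.
Lemma ZtoCN a : ZtoC (- a)%coqZ = - ZtoC a.
Proof. by rewrite /ZtoC (rmorphN int_of_Z) rmorphN. Qed.
Lemma ZtoCB a b : ZtoC (a - b)%coqZ = ZtoC a - ZtoC b.
Proof. by rewrite -ZtoCN -ZtoCD; congr ZtoC; lia. Qed.
Lemma ZtoC_inj a b : ZtoC a = ZtoC b -> a = b.
Proof. by move=> /intr_inj/(can_inj int_of_ZK). Qed.
Lemma ZtoC_conj a : (ZtoC a)^* = ZtoC a.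
Proof. exact: rmorph_int. Qed.

Lemma ZtoC0 : ZtoC 0 = 0. Proof. by []. Qed.
Lemma ZtoC1 : ZtoC 1 = 1. Proof. by []. Qed.
Lemma ZtoC2 : ZtoC 2 = 2. Proof. by []. Qed.
Lemma ZtoC3 : ZtoC 3 = 3. Proof. by []. Qed.
Definition ZtoCE := (ZtoCB, ZtoCD, ZtoCM, ZtoCN, ZtoC0, ZtoC1, ZtoC2, ZtoC3).

Definition OtoC (x : OZ) : C := ZtoC x.1 + ZtoC x.2 * omega.

Lemma OtoC0 : OtoC (0, 0)%coqZ = 0. Proof. by rewrite /OtoC !ZtoCE mul0r addr0. Qed.
Lemma OtoC1 : OtoC (1, 0)%coqZ = 1. Proof. by rewrite /OtoC !ZtoCE mul0r addr0. Qed.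
Lemma OtoCN1 : OtoC (-1, 0)%coqZ = -1. Proof. by rewrite /OtoC mul0r addr0. Qed.
Lemma OtoCD x y : OtoC (addO x y) = OtoC x + OtoC y.
Proof. by rewrite /OtoC !ZtoCE; ring. Qed.
Lemma OtoCN x : OtoC (oppO x) = - OtoC x.
Proof. by rewrite /OtoC !ZtoCE; ring. Qed.
Lemma OtoCM x y : OtoC (mulO x y) = OtoC x * OtoC y.
Proof. by rewrite /OtoC !ZtoCE /=; ring: (omega11_sqr R). Qed.
Lemma OtoC_conj x : OtoC (conjO x) = (OtoC x)^*.
Proof. by rewrite /OtoC !ZtoCE rmorphD rmorphM /= !ZtoC_conj omega11_conj; ring. Qed.
Lemma OtoC_norm x : OtoC x * (OtoC x)^* = ZtoC (normO x).
Proof. by rewrite -OtoC_conj /OtoC !ZtoCE /=; ring: (omega11_sqr R). Qed.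
Lemma OtoC_tr x : OtoC x + (OtoC x)^* = ZtoC (trO x).
Proof. by rewrite -OtoC_conj /OtoC !ZtoCE /=; ring. Qed.

Lemma isqrt11E : isqrt11 R = OtoC (-1, 2)%coqZ.
Proof. by rewrite /OtoC /omega11 /= ZtoC2 (_ : ZtoC (-1) = -1) //; field. Qed.

Lemma omega11E : omega = OtoC (0, 1)%coqZ.
Proof. by rewrite /OtoC !ZtoCE add0r mul1r. Qed.

(** Since omega^2 = omega - 3, every integer polynomial in omega reduces to a
    linear one. *)
Lemma O11P (x : C) : O11 R x <-> exists y, x = OtoC y.
Proof.
split=> [[p _ <-]|[[a b] ->]].
  elim/poly_ind: p => [|p c [y IHp]].
    by exists (0, 0)%coqZ; rewrite rmorph0 horner0 OtoC0.
  exists (addO (mulO y (0, 1)%coqZ) (Z_of_int c, 0)%coqZ).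
  rewrite rmorphD rmorphM /= map_polyX map_polyC hornerMXaddC IHp OtoCD OtoCM.
  by rewrite /OtoC /= ZtoC0 ZtoC1 /ZtoC Z_of_intK; ring.
exists (int_of_Z b *: 'X + (int_of_Z a)%:P) => //.
rewrite /OtoC; move: omega => o.
by rewrite rmorphD /= map_polyZ map_polyX map_polyC !hornerE addrC.
Qed.

Definition integral (A : 'M[C]_3) := forall i j, exists x, A i j = OtoC x.

Definition mat3 (a b c d e f g h k : C) : 'M[C]_3 :=
  mx3 [:: [:: a; b; c]; [:: d; e; f]; [:: g; h; k]].

Lemma mat3_eta (A : 'M[C]_3) :
  A = mat3 (A 0 0) (A 0 1) (A 0 2) (A 1 0) (A 1 1) (A 1 2) (A 2 0) (A 2 1) (A 2 2).
Proof.
apply/matrixP => -[[|[|[|//]]] ?] [[|[|[|//]]] ?]; rewrite !mxE /=;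
  by congr (A _ _); apply/val_inj.
Qed.

Lemma mat3_1 : 1%:M = mat3 1 0 0 0 1 0 0 0 1.
Proof. by apply/matrixP => -[[|[|[|//]]] ?] [[|[|[|//]]] ?]; rewrite !mxE. Qed.

Lemma sum3 (F : 'I_3 -> C) : \sum_i F i = F 0 + F 1 + F 2.
Proof.
rewrite !big_ord_recl big_ord0 addr0 addrA.
by congr (F _ + F _ + F _); apply/val_inj.
Qed.

Lemma mat3_mul a b c d e f g h k a' b' c' d' e' f' g' h' k' :
  mat3 a b c d e f g h k *m mat3 a' b' c' d' e' f' g' h' k' =
  mat3 (a * a' + b * d' + c * g') (a * b' + b * e' + c * h') (a * c' + b * f' + c * k')
      (d * a' + e * d' + f * g') (d * b' + e * e' + f * h') (d * c' + e * f' + f * k')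
      (g * a' + h * d' + k * g') (g * b' + h * e' + k * h') (g * c' + h * f' + k * k').
Proof.
by apply/matrixP => -[[|[|[|//]]] ?] [[|[|[|//]]] ?]; rewrite mxE sum3 !mxE.
Qed.

(** The Gram matrix of the columns of A is that of the standard basis. *)
Lemma gram (A : 'M[C]_3) (i j : 'I_3) : preserves_herm A ->
  A 0 i * (A 2 j)^* + A 1 i * (A 1 j)^* + A 2 i * (A 0 j)^* = (j == rev_ord i)%:R.
Proof.
move=> /(_ (delta_mx i 0) (delta_mx j 0)); rewrite -!colE /herm !mxE => ->.
case: i => [[|[|[|//]]] ?]; case: j => [[|[|[|//]]] ?];
  by rewrite -!val_eqE /= ?(conjC0, conjC1, mulr0, mul0r, mulr1, addr0, add0r).
Qed.

(** The form has the antidiagonal permutation matrix J as its matrix, so the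
    inverse of A is J A^* J. *)
Lemma inv_entry (A : U21 R) i j :
  ((A^-1)%g : U21 R) i j = ((A : 'M[C]_3) (rev_ord j) (rev_ord i))^*.
Proof.
have uA := preserves_herm_unit (U21P A).
pose L := \matrix_(k < 3, l < 3) ((A : 'M[C]_3) (rev_ord l) (rev_ord k))^*.
suff LA : L *m A = 1%:M.
  change (invmx A i j = ((A : 'M[C]_3) (rev_ord j) (rev_ord i))^*).
  by rewrite -[invmx A]mul1mx -LA -mulmxA mulmxV // mulmx1 mxE.
apply/matrixP => k l; rewrite !mxE sum3 !mxE.
have -> : (k == l) = (rev_ord k == rev_ord l) by rewrite (eqtype.inj_eq (@rev_ord_inj _)).
rewrite -(@gram A l (rev_ord k) (U21P A)) ![_^* * _]mulrC.
by congr (_ * (A _ _)^* + _ * (A _ _)^* + _ * (A _ _)^*); apply/val_inj.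
Qed.

Lemma integral1 : integral 1%:M.
Proof.
move=> i j; rewrite mxE; case: (i == j); [exists (1, 0)%coqZ|exists (0, 0)%coqZ].
  by rewrite OtoC1.
by rewrite OtoC0.
Qed.

Lemma integralM A B : integral A -> integral B -> integral (A *m B).
Proof.
move=> hA hB i j; rewrite mxE sum3.
have [x1 ->] := hA i 0; have [x2 ->] := hA i 1; have [x3 ->] := hA i 2.
have [y1 ->] := hB 0 j; have [y2 ->] := hB 1 j; have [y3 ->] := hB 2 j.
by exists (addO (addO (mulO x1 y1) (mulO x2 y2)) (mulO x3 y3)); rewrite !OtoCD !OtoCM.
Qed.

Lemma integralV (A : U21 R) : integral A -> integral (A^-1)%g.
Proof.
move=> hA i j; have [x hx] := hA (rev_ord j) (rev_ord i).
by exists (conjO x); rewrite inv_entry hx OtoC_conj.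
Qed.

Lemma integral_mx3 (s : seq (seq OZ)) :
  integral (mx3 (map (map OtoC) s)).
Proof.
move=> i j; rewrite mxE; exists (nth (0, 0)%coqZ (nth [::] s i) j).
have [si|si] := ltnP i (size s); last first.
  by rewrite (nth_default [::]) ?size_map // (nth_default [::] si) !nth_nil OtoC0.
rewrite (nth_map [::]) //.
have [sj|sj] := ltnP j (size (nth [::] s i)).
  by rewrite (nth_map (0, 0)%coqZ).
by rewrite (nth_default 0) ?size_map // (nth_default _ sj) OtoC0.
Qed.

(** * Moves and words as unitary matrices *)

Definition heis_mx a b j : 'M[C]_3 :=
  mat3 1 (OtoC (oppO (conjO (a, b)))) (OtoC (shift_corner a b j))
      0 1 (OtoC (a, b))
      0 0 1.

Lemma trO_shift_corner a b j : trO (shift_corner a b j) = (- normO (a, b))%coqZ.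
Proof. by rewrite /trO /shift_corner /=; lia. Qed.

Lemma mulmx_entry (A : 'M[C]_3) (z : 'cV[C]_3) i :
  (A *m z) i 0 = A i 0 * z 0 0 + A i 1 * z 1 0 + A i 2 * z 2 0.
Proof. by rewrite mxE sum3. Qed.

Lemma heis_mxP a b j : preserves_herm (heis_mx a b j).
Proof.
move=> z w; rewrite /herm !mulmx_entry !mxE /= OtoCN OtoC_conj.
have := OtoC_tr (shift_corner a b j); rewrite trO_shift_corner ZtoCN -OtoC_norm.
move: (OtoC (a, b)) (OtoC (shift_corner a b j)) => t v htv.
rewrite !(rmorphD, rmorphM, rmorphN, rmorph1, rmorph0) /= conjCK.
have -> : v^* = - (t * t^*) - v by rewrite -htv addrC addKr.
ring.
Qed.

Definition heisU a b j : U21 R := mkU21 (heis_mxP a b j).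

Lemma heisU_mul a b j a' b' j' : (heisU a b j * heisU a' b' j')%g =
  heisU (a + a') (b + b') (j + j' + (a + b) * a' + 3 * (b * b')).
Proof.
apply/val_inj => /=; rewrite mat3_mul.
rewrite /heis_mx -!OtoC1 -!OtoC0 -!OtoCM -!OtoCD.
by congr mat3; congr OtoC; congr pair; rewrite /= /normO /=; lia.
Qed.

Lemma heisU_inv a b j : (heisU a b j)^-1%g = heisU (- a) (- b) (normO (a, b) - j).
Proof.
set h' := heisU (- a) _ _; suff hh' : (heisU a b j * h' = 1)%g.
  by rewrite -[LHS]mulg1 -hh' mulKg.
rewrite heisU_mul; apply/val_inj; rewrite /= mat3_1 /heis_mx -!OtoC1 -!OtoC0.
by congr mat3; congr OtoC; congr pair; rewrite /= /normO /=; lia.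
Qed.

Lemma heisU_integral a b j : integral (heisU a b j).
Proof.
suff -> : heisU a b j = mx3 (map (map OtoC)
  [:: [:: (1, 0); oppO (conjO (a, b)); shift_corner a b j];
      [:: (0, 0); (1, 0); (a, b)]; [:: (0, 0); (0, 0); (1, 0)]]%coqZ) :> 'M[C]_3.
  exact: integral_mx3.
by rewrite /= /heis_mx /mat3 OtoC0 OtoC1.
Qed.

Definition move_U (m : move) : U21 R :=
  match m with
  | Shift a b j => heisU a b j
  | Flip => mkU21 (@I0_mxP R)
  end.

Lemma flip_integral : integral (I0_mx R).
Proof.
suff -> : I0_mx R = mx3 (map (map OtoC)
  [:: [:: (0, 0); (0, 0); (1, 0)]; [:: (0, 0); (-1, 0); (0, 0)];
      [:: (1, 0); (0, 0); (0, 0)]]%coqZ).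
  exact: integral_mx3.
by rewrite /= /I0_mx OtoC0 OtoC1 OtoCN1.
Qed.

Lemma R1_integral : integral (R1_mx R).
Proof.
suff -> : R1_mx R = mx3 (map (map OtoC)
  [:: [:: (1, 0); (0, 0); (0, 0)]; [:: (0, 0); (-1, 0); (0, 0)];
      [:: (0, 0); (0, 0); (1, 0)]]%coqZ).
  exact: integral_mx3.
by rewrite /= /R1_mx OtoC0 OtoC1 OtoCN1.
Qed.

Lemma R2_integral : integral (R2_mx R).
Proof.
suff -> : R2_mx R = mx3 (map (map OtoC)
  [:: [:: (1, 0); (1, 0); oppO (conjO (0, 1))]; [:: (0, 0); (-1, 0); (1, 0)];
      [:: (0, 0); (0, 0); (1, 0)]]%coqZ).
  exact: integral_mx3.
by rewrite /= /R2_mx omega11E OtoCN OtoC_conj OtoC0 OtoC1 OtoCN1.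
Qed.

Lemma R3_integral : integral (R3_mx R).
Proof.
suff -> : R3_mx R = mx3 (map (map OtoC)
  [:: [:: (1, 0); conjO (0, 1); addO (-1, 0) (oppO (conjO (0, 1)))];
      [:: (0, 0); (-1, 0); (0, 1)]; [:: (0, 0); (0, 0); (1, 0)]]%coqZ).
  exact: integral_mx3.
by rewrite /= /R3_mx omega11E OtoCD OtoCN OtoC_conj OtoC0 OtoC1 OtoCN1.
Qed.

Lemma T_integral : integral (T_mx R).
Proof.
suff -> : T_mx R = mx3 (map (map OtoC)
  [:: [:: (1, 0); (0, 0); (-1, 2)]; [:: (0, 0); (1, 0); (0, 0)];
      [:: (0, 0); (0, 0); (1, 0)]]%coqZ).
  exact: integral_mx3.
by rewrite /= /T_mx isqrt11E OtoC0 OtoC1.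
Qed.

Lemma move_U_integral m : integral (move_U m).
Proof. by case: m => [a b j|]; [apply: heisU_integral|apply: flip_integral]. Qed.

Definition first_col (A : 'M[C]_3) (z : vecO) :=
  [/\ A 0 0 = OtoC (v1 z), A 1 0 = OtoC (v2 z) & A 2 0 = OtoC (v3 z)].

Lemma move_first_col m (A : U21 R) z :
  first_col A z -> first_col (move_U m * A)%g (move_vec m z).
Proof.
move=> [z1 z2 z3]; case: m => [a b j|]; split; rewrite /= mxE sum3 z1 z2 z3 !mxE /=;
  rewrite ?OtoCD ?OtoCN ?OtoCM ?OtoC_conj; ring.
Qed.

Definition word_U (g : seq move) : U21 R :=
  foldl (fun B m => (move_U m * B)%g) 1%g g.

Lemma word_U_integral g : integral (word_U g).
Proof.
elim/last_ind: g => [|g m IHg]; first exact: integral1.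
by rewrite /word_U foldl_rcons; apply: integralM IHg; apply: move_U_integral.
Qed.

Lemma word_first_col g (A : U21 R) z :
  first_col A z -> first_col (word_U g * A)%g (word_vec g z).
Proof.
elim/last_ind: g => [|g m IHg] Az; first by rewrite mul1g.
by rewrite /word_U /word_vec !foldl_rcons -mulgA; apply/move_first_col/IHg.
Qed.

Lemma first_col_null (A : U21 R) z : first_col A z -> null z.
Proof.
move=> [z1 z2 z3]; have := gram 0 0 (U21P A); rewrite z1 z2 z3.
rewrite -!OtoC_conj -!OtoCM => h; apply: ZtoC_inj; rewrite ZtoC0.
rewrite ZtoCD -OtoC_tr -OtoC_norm -!OtoC_conj -!OtoCM.
have -> : conjO (mulO (v1 z) (conjO (v3 z))) = mulO (v3 z) (conjO (v1 z)).
  by rewrite /conjO /mulO /=; congr pair; lia.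
by rewrite addrA [OtoC (mulO (v2 z) _) + _]addrC; exact: h.
Qed.

Lemma integral_first_col (A : 'M[C]_3) : integral A -> exists z, first_col A z.
Proof.
move=> hA; have [x hx] := hA 0 0; have [y hy] := hA 1 0; have [t ht] := hA 2 0.
by exists (VecO x y t).
Qed.

(** * The generated group *)

Definition picard_gens : set (PU21 R) :=
  [set PU_I0 R; PU_R1 R; PU_R2 R; PU_R3 R; PU_T R]%classic.

(** Stated on matrices, so that the argument takes place in U(2,1) rather than in
    the quotient. *)
Definition in_gen (A : U21 R) := generated picard_gens (PU21_class A).

Lemma generated_subgroup (G : groupType) (S : set G) : subgroup (generated S).
Proof.
split=> [H [] []//|x y Sx Sy H HS|x Sx H HS].
- by have [[_ HM _] _] := HS; apply: HM (Sx _ HS) (Sy _ HS).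
- by have [[_ _ HV] _] := HS; apply: HV (Sx _ HS).
Qed.

Lemma in_gen_mul A B : in_gen A -> in_gen B -> in_gen (A * B)%g.
Proof.
rewrite /in_gen PU21_classM; have [_ + _] := generated_subgroup picard_gens; exact.
Qed.

Lemma in_gen_inv A : in_gen A -> in_gen A^-1%g.
Proof.
rewrite /in_gen PU21_classV; have [_ _ +] := generated_subgroup picard_gens; exact.
Qed.

Lemma in_gen1 : in_gen 1%g.
Proof. by have [] := generated_subgroup picard_gens. Qed.

Lemma in_gen_gen A : picard_gens (PU21_class A) -> in_gen A.
Proof. exact: sub_gen_smallest. Qed.

Lemma in_gen_I0 : in_gen (mkU21 (@I0_mxP R)).
Proof. by apply: in_gen_gen; do 4!left. Qed.
Lemma in_gen_R1 : in_gen (mkU21 (@R1_mxP R)).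
Proof. by apply: in_gen_gen; do 3!left; right. Qed.
Lemma in_gen_R2 : in_gen (mkU21 (@R2_mxP R)).
Proof. by apply: in_gen_gen; do 2!left; right. Qed.
Lemma in_gen_R3 : in_gen (mkU21 (@R3_mxP R)).
Proof. by apply: in_gen_gen; left; right. Qed.
Lemma in_gen_T : in_gen (mkU21 (@T_mxP R)). Proof. by apply: in_gen_gen; right. Qed.

(** * Generating the stabilizer of infinity *)

Lemma in_gen_heis_T : in_gen (heisU 0 0 1).
Proof.
suff -> : heisU 0 0 1 = mkU21 (@T_mxP R) by exact: in_gen_T.
by apply/val_inj; rewrite /= /heis_mx /T_mx isqrt11E -OtoC0 -OtoC1.
Qed.

Lemma in_gen_heis1 : in_gen (heisU 1 0 1).
Proof.
suff -> : heisU 1 0 1 = (mkU21 (@R2_mxP R) * mkU21 (@R1_mxP R))%g.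
  exact: in_gen_mul in_gen_R2 in_gen_R1.
apply/val_inj; rewrite /= -/(mat3 _ _ _ _ _ _ _ _ _) -[R1_mx R]/(mat3 _ _ _ _ _ _ _ _ _).
rewrite /heis_mx mat3_mul omega11E -OtoC_conj -OtoC0 -OtoC1 -!(OtoCN, OtoCM, OtoCD).
by congr mat3; congr OtoC; congr pair; rewrite /= /normO /=; lia.
Qed.

Lemma in_gen_heis_omega : in_gen (heisU 0 1 2).
Proof.
suff -> : heisU 0 1 2 = (mkU21 (@R3_mxP R) * mkU21 (@R1_mxP R))%g.
  exact: in_gen_mul in_gen_R3 in_gen_R1.
apply/val_inj; rewrite /= -/(mat3 _ _ _ _ _ _ _ _ _) -[R1_mx R]/(mat3 _ _ _ _ _ _ _ _ _).
rewrite /heis_mx mat3_mul omega11E -OtoC_conj -OtoC0 -OtoC1 -!(OtoCN, OtoCM, OtoCD).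
by congr mat3; congr OtoC; congr pair; rewrite /= /normO /=; lia.
Qed.

(** Left multiplication by the translations T, R_2 R_1, R_3 R_1 and their
    inverses changes j, a and b by one. *)
Lemma in_gen_heis a b j : in_gen (heisU a b j).
Proof.
have cast a1 b1 j1 a2 b2 j2 : in_gen (heisU a1 b1 j1) ->
    a1 = a2 -> b1 = b2 -> j1 = j2 -> in_gen (heisU a2 b2 j2).
  by move=> h <- <- <-.
elim/Z.peano_ind: b a j => [a|b IHb a j|b IHb a j].
- elim/Z.peano_ind: a => [j|a IHa j|a IHa j].
  + elim/Z.peano_ind: j => [|j IHj|j IHj].
    * have := in_gen_mul in_gen_heis_T (in_gen_inv in_gen_heis_T).
      by rewrite heisU_inv heisU_mul.
    * have := in_gen_mul in_gen_heis_T IHj; rewrite heisU_mul => /cast; apply; lia.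
    * have := in_gen_mul (in_gen_inv in_gen_heis_T) IHj.
      by rewrite heisU_inv heisU_mul => /cast; apply; rewrite /normO /=; lia.
  + have := in_gen_mul in_gen_heis1 (IHa (j - 1 - a)%coqZ).
    by rewrite heisU_mul => /cast; apply; lia.
  + have := in_gen_mul (in_gen_inv in_gen_heis1) (IHa (j + a)%coqZ).
    by rewrite heisU_inv heisU_mul => /cast; apply; rewrite /normO /=; lia.
- have := in_gen_mul in_gen_heis_omega (IHb a (j - 2 - a - 3 * b)%coqZ).
  by rewrite heisU_mul => /cast; apply; lia.
- have := in_gen_mul (in_gen_inv in_gen_heis_omega) (IHb a (j - 1 + a + 3 * b)%coqZ).
  by rewrite heisU_inv heisU_mul => /cast; apply; rewrite /normO /=; lia.
Qed.

Lemma in_gen_word g : in_gen (word_U g).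
Proof.
elim/last_ind: g => [|g m IHg]; first exact: in_gen1.
rewrite /word_U foldl_rcons; apply: in_gen_mul => //.
by case: m => [a b j|]; [apply: in_gen_heis|apply: in_gen_I0].
Qed.

Lemma preserves_hermN (A : 'M[C]_3) : preserves_herm A -> preserves_herm (- A).
Proof.
by move=> hA z w; rewrite -[RHS]hA !mulNmx /herm !mxE !rmorphN !mulrNN.
Qed.

(** The scalar matrix -1 is e^(i pi) and so trivial in PU(2,1). *)
Lemma in_gen_opp (A : U21 R) : in_gen (mkU21 (preserves_hermN (U21P A))) -> in_gen A.
Proof.
rewrite /in_gen; congr (generated _ _); apply/PU21_classP; exists pi => /=.
have -> : expi pi = -1 :> C by apply/eqP; rewrite eq_complex /= cospi sinpi oppr0 !eqxx.
by rewrite mul_scalar_mx scaleN1r.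
Qed.

(** Taking norms reduces this to the fact that 1 and -1 are the only units. *)
Lemma OtoC_unit x y : OtoC x * (OtoC y)^* = 1 -> OtoC x = 1 \/ OtoC x = -1.
Proof.
move=> xy; have nxy : (normO x * normO y = 1)%coqZ.
  apply: ZtoC_inj; rewrite ZtoCM -!OtoC_norm ZtoC1.
  rewrite -[RHS](rmorph1 Num.conj) -xy rmorphM /= conjCK -[RHS]mul1r -xy; ring.
have [nx _] := Z.eq_mul_1_nonneg _ _ (@normO_ge0 x) nxy.
by have [->|->] := normO_eq1 nx; rewrite ?OtoC1 ?OtoCN1; [left|right].
Qed.

(** The Gram relations between the last two columns are the relations between
    the entries of a Heisenberg translation. *)
Lemma in_gen_unipotent (A : U21 R) : integral A ->
  A 0 0 = 1 -> A 1 0 = 0 -> A 1 1 = 1 -> A 2 0 = 0 -> A 2 1 = 0 -> A 2 2 = 1 ->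
  in_gen A.
Proof.
move=> hA a00 a10 a11 a20 a21 a22.
have [[a b] hab] := hA 1 2; have [[m k] hmk] := hA 0 2.
have a01 : A 0 1 = - (OtoC (a, b))^*.
  have := gram 1 2 (U21P A); rewrite a11 a21 a22 hab rmorph1 mulr1 mul1r mul0r addr0.
  by move/eqP; rewrite addr_eq0 => /eqP.
have mk : (2 * m + k = - normO (a, b))%coqZ.
  apply: ZtoC_inj; rewrite ZtoCN -OtoC_norm -[LHS]/(ZtoC (trO (m, k))) -OtoC_tr.
  have := gram 2 2 (U21P A); rewrite a22 hab hmk rmorph1 mulr1 mul1r addrAC.
  by move/eqP; rewrite addr_eq0 => /eqP.
suff -> : A = heisU a b (- m) by exact: in_gen_heis.
apply/val_inj; rewrite /= [LHS]mat3_eta a00 a10 a11 a20 a21 a22 a01 hab hmk.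
rewrite /heis_mx OtoCN OtoC_conj; congr (mat3 _ _ (OtoC _) _ _ _ _ _ _).
by congr pair; lia.
Qed.

(** The middle entry is 1 or -1, and R_1 changes its sign. *)
Lemma in_gen_stabilizer1 (A : U21 R) : integral A ->
  A 0 0 = 1 -> A 1 0 = 0 -> A 2 0 = 0 -> in_gen A.
Proof.
move=> hA a00 a10 a20.
have a22 : A 2 2 = 1.
  have := gram 0 2 (U21P A); rewrite a10 a20 a00 !mul0r !addr0 mul1r => a22.
  by rewrite -[LHS]conjCK a22 rmorph1.
have a21 : A 2 1 = 0.
  have := gram 0 1 (U21P A); rewrite a10 a20 a00 !mul0r !addr0 mul1r => a21.
  by rewrite -[LHS]conjCK a21 rmorph0.
have [e he] := hA 1 1.
have ee : OtoC e * (OtoC e)^* = 1.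
  have := gram 1 1 (U21P A); rewrite a21 he rmorph0 mulr0 mul0r addr0 add0r; exact.
have [e1|eN1] := OtoC_unit ee; first by apply: in_gen_unipotent; rewrite ?he.
set B := (mkU21 (@R1_mxP R) * A)%g.
rewrite -[A](mulKg (mkU21 (@R1_mxP R))) -/B.
apply: in_gen_mul (in_gen_inv in_gen_R1) _.
apply: in_gen_unipotent; first exact: integralM R1_integral hA.
all: by rewrite /= mxE sum3 !mxE /= ?(a00, a10, a20, a21, a22, he, eN1);
  rewrite ?(mul0r, mul1r, mulr0, mulr1, addr0, add0r, mulN1r, opprK, oppr0).
Qed.

Lemma in_gen_stabilizer (A : U21 R) : integral A -> A 1 0 = 0 -> A 2 0 = 0 -> in_gen A.
Proof.
move=> hA a10 a20.
have [x hx] := hA 0 0; have [y hy] := hA 2 2.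
have xy : OtoC x * (OtoC y)^* = 1.
  by have := gram 0 2 (U21P A); rewrite a10 a20 hx hy !mul0r !addr0.
have [x1|xN1] := OtoC_unit xy.
  by apply: in_gen_stabilizer1; rewrite ?hx.
apply: in_gen_opp; apply: in_gen_stabilizer1.
- by move=> i j; have [t ht] := hA i j; exists (oppO t); rewrite mxE ht OtoCN.
- by rewrite mxE hx xN1 opprK.
- by rewrite mxE a10 oppr0.
- by rewrite mxE a20 oppr0.
Qed.

(** The descent brings A to the stabilizer of infinity: once the last entry of
    the first column is 0, nullity kills the middle one. *)
Lemma in_gen_integral (A : U21 R) : integral A -> in_gen A.
Proof.
move=> hA; have [z Az] := integral_first_col hA.
have [g gz] := reach_horizontal (first_col_null Az).
have Bz := word_first_col g Az; set B := (word_U g * A)%g in Bz.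
suff hB : in_gen B.
  rewrite -[A](mulKg (word_U g)).
  exact: in_gen_mul (in_gen_inv (in_gen_word g)) hB.
have z2 : v2 (word_vec g z) = (0, 0)%coqZ.
  have := word_vec_null g (first_col_null Az); rewrite /null gz => n0; apply: normO_eq0.
  by move: n0; rewrite /mulO /trO /=; lia.
have [_ b1 b2] := Bz; apply: in_gen_stabilizer.
- exact: integralM (word_U_integral g) hA.
- by rewrite b1 z2 OtoC0.
- by rewrite b2 gz OtoC0.
Qed.

(** * Conclusion *)

Lemma PU21_overP (x : PU21 R) :
  PU21_over (O11 R) x <-> exists2 A : U21 R, integral A & PU21_class A = x.
Proof.
split=> [[A hA <-]|[A hA <-]]; exists A => // i j.
- by have /O11P := hA i j.
- exact/O11P/hA.
Qed.

Lemma PU21_over_subgroup : subgroup (PU21_over (O11 R)).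
Proof.
split=> [|x y /PU21_overP[A hA <-] /PU21_overP[B hB <-]|x /PU21_overP[A hA <-]];
  apply/PU21_overP.
- by exists 1%g => //; apply: integral1.
- by exists (A * B)%g; [apply: integralM|rewrite PU21_classM].
- by exists (A^-1)%g; [apply: integralV|rewrite PU21_classV].
Qed.

End Matrices.

Local Open Scope classical_set_scope.

Theorem theorem4p5 (R : realType) :
  PU21_over (O11 R) =
  generated [set PU_I0 R; PU_R1 R; PU_R2 R; PU_R3 R; PU_T R].
Proof.
apply/seteqP; split=> [x /PU21_overP[A hA <-]|]; first exact: in_gen_integral.
apply: smallest_sub; first exact: PU21_over_subgroup.
move=> x [[[[]|]|]|] ->; apply/PU21_overP; eexists; try by [].
- exact: flip_integral.
- exact: R1_integral.
- exact: R2_integral.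
- exact: R3_integral.
- exact: T_integral.
Qed.
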